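(* Let $G$ be a second countable locally compact Hausdorff groupoid with a fixed left Haar system $\lambda=\{\lambda^u\}_{u\in G^0}$, and let $(\Phi,\Psi)$ be a complementary pair of $N$-functions with $\Phi\in\Delta_2$. For $f\in C_c(G)$, the function $g:G^0\to\mathbb R$, $g(u)=\|f^u\|_\Phi$, where $f^u=f|_{G^u}$ and $\|\cdot\|_\Phi$ is the Orlicz norm on $L^\Phi(G^u)$, is continuous on $G^0$ with compact support.
   Context: $G^0$ is the unit space, $r(x)=xx^{-1}$, $d(x)=x^{-1}x$, $G^u=r^{-1}(u)$. The left Haar system consists of positive Radon measures $\lambda^u$ with support $G^u$ such that $u\mapsto\int f\,d\lambda^u$ is continuous for every $f\in C_c(G)$ and $\int f(xy)d\lambda^{d(x)}(y)=\int f(y)d\lambda^{r(x)}(y)$. An $N$-function is a continuous even convex $\Phi:\mathbb R\to[0,\infty)$ with $\Phi(x)=0$ iff $x=0$, $\Phi(x)/x\to0$ as $x\to0$, $\Phi(x)/x\to\infty$ as $x\to\infty$; complementary function $\Psi(y)=\sup_{x\ge0}(x|y|-\Phi(x))$. $\Phi\in\Delta_2$: there is $k>0$ with $\Phi(2x)\le k\Phi(x)$ for all $x\ge0$ ($G$ non-compact), resp. for all $x\ge x_0$ for some $x_0>0$ ($G$ compact). $L^\Phi(G^u)$ is the space of measurable $h$ on $G^u$ with $\int\Phi(\alpha|h|)d\lambda^u<\infty$ for some $\alpha>0$; its Orlicz norm is $\|h\|_\Phi=\sup\{\int_{G^u}|hk|\,d\lambda^u:\int_{G^u}\Psi(|k|)d\lambda^u\le1\}$.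 *)

(* Defs.v *)
From HB Require Import structures.
From mathcomp Require Import all_boot all_order all_algebra.
From mathcomp Require Import all_classical all_reals all_analysis.
Import Order.TTheory GRing.Theory Num.Theory numFieldNormedType.Exports.

Set Implicit Arguments.
Unset Strict Implicit.
Unset Printing Implicit Defensive.

Local Open Scope classical_set_scope.
Local Open Scope ring_scope.

(* Groupoids (Renault's axioms) given by a set of composable pairs G2, *)
(* a multiplication mul (meaningful on G2) and an inversion inv.       *)
Section Groupoid.
Variable T : Type.
Variables (G2 : set (T * T)) (mul : T -> T -> T) (inv : T -> T).

Definition is_groupoid : Prop :=
  [/\ (forall x y z, G2 (x, y) -> G2 (y, z) ->
         [/\ G2 (mul x y, z), G2 (x, mul y z) &
             mul (mul x y) z = mul x (mul y z)]),
      (forall x, inv (inv x) = x),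
      (forall x, G2 (x, inv x)) &
      (forall x y, G2 (x, y) ->
         mul (mul x y) (inv y) = x /\ mul (inv x) (mul x y) = y)].

Definition rng (x : T) : T := mul x (inv x).
Definition src (x : T) : T := mul (inv x) x.

Definition units : set T := range rng.

Definition fiber (u : T) : set T := [set x | rng x = u].

End Groupoid.

Definition top_groupoid (T : ptopologicalType)
  (G2 : set (T * T)) (mul : T -> T -> T) (inv : T -> T) : Prop :=
  [/\ is_groupoid G2 mul inv, continuous inv &
      {within G2, continuous (fun p : T * T => mul p.1 p.2)}].

Notation borel T := (g_sigma_algebraType (@open T)).

Section Measures.
Context {R : realType} {T : ptopologicalType}.
Local Open Scope ereal_scope.

Definition Cc (f : T -> R) : Prop :=
  continuous f /\ compact (closure [set x | f x != 0%R]).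

Definition radon (mu : {measure set (borel T) -> \bar R}) : Prop :=
  [/\ (forall K : set T, compact K -> mu K < +oo),
      (forall A : set (borel T), measurable A ->
         mu A = ereal_inf [set mu U | U in [set U : set T | open U /\ A `<=` U]]) &
      (forall U : set T, open U ->
         mu U = ereal_sup [set mu K | K in [set K : set T | compact K /\ K `<=` U]])].

Definition msupport (mu : {measure set (borel T) -> \bar R}) : set T :=
  [set x | forall U : set T, open U -> U x -> 0 < mu U].

Definition haar_system (G2 : set (T * T)) (mul : T -> T -> T) (inv : T -> T)
  (lam : T -> {measure set (borel T) -> \bar R}) : Prop :=
  [/\ (forall u, units mul inv u ->
         radon (lam u) /\ msupport (lam u) = fiber mul inv u),
      (forall f : T -> R, Cc f ->
         {within units mul inv,
           continuous (fun u => \int[lam u]_x (f x)%:E)}) &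
      (forall (f : T -> R) (x : T), Cc f ->
         \int[lam (src mul inv x)]_(y in fiber mul inv (src mul inv x))
             (f (mul x y))%:E
         = \int[lam (rng mul inv x)]_y (f y)%:E)].

(* Orlicz norm on L^Phi(D, mu), Psi being the complementary function *)
Definition orlicz_norm (Psi : R -> R) (mu : {measure set (borel T) -> \bar R})
  (D : set T) (h : T -> R) : \bar R :=
  ereal_sup [set \int[mu]_(x in D) (`|h x * k x|)%:E
            | k in [set k : T -> R | measurable_fun (D : set (borel T)) k /\
                      \int[mu]_(x in D) (Psi `|k x|)%:E <= 1]].
End Measures.

Section Nfunctions.
Context {R : realType}.

Definition N_function (Phi : R -> R) : Prop :=
  [/\ continuous Phi,
      (forall x, Phi (- x) = Phi x) &
      (forall x y t, 0 <= t <= 1 ->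
          Phi (t * x + (1 - t) * y) <= t * Phi x + (1 - t) * Phi y)] /\
  [/\ (forall x, 0 <= Phi x),
      (forall x, Phi x = 0 <-> x = 0),
      (fun x => Phi x / x) x @[x --> 0^'] --> 0 &
      (fun x => Phi x / x) x @[x --> +oo] --> +oo].

Definition compl_fun (Phi : R -> R) (y : R) : R :=
  sup [set x * `|y| - Phi x | x in [set x : R | 0 <= x]].

Definition Delta2_global (Phi : R -> R) : Prop :=
  exists k, 0 < k /\ forall x, 0 <= x -> Phi (2 * x) <= k * Phi x.

Definition Delta2_infty (Phi : R -> R) : Prop :=
  exists k x0, [/\ 0 < k, 0 < x0 &
                   forall x, x0 <= x -> Phi (2 * x) <= k * Phi x].

Definition Delta2 (T : ptopologicalType) (Phi : R -> R) : Prop :=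
  (compact [set: T] -> Delta2_infty Phi) /\
  (~ compact [set: T] -> Delta2_global Phi).
End Nfunctions.

(* Main.v *)
(* Write N(u) for the norm of f on the fiber G^u, phi(x) for the slope of the
   chord of Phi over [x, (1 + eta) x], and h = phi (a |f|), which lies in C_c(G).
   Young's inequality gives the upper bound
     N(u) <= P(u) = (1 + int Phi(a |f|) dlam^u) / a,
   and testing the supremum against h gives the lower bound
     N(u) >= Q(u) = int |f h| dlam^u / max (1, int Psi(h) dlam^u).
   Both bounds only involve integrals of C_c functions, so they are continuous
   in u by the Haar system axiom.  The chord slope satisfies
     Phi x + Psi (phi x) <= (1 + eta) x (phi x),
   hence P(u0) <= (1 + eta) Q(u0) as soon as int Psi(h) dlam^u0 = 1; such an a
   exists by the intermediate value theorem when f does not vanish on G^u0.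
   Squeezing N between Q and P gives continuity at u0; if f vanishes on G^u0,
   the bound P with a large suffices. *)
Require Import Defs.
From HB Require Import structures.
From mathcomp Require Import all_boot all_order all_algebra.
From mathcomp Require Import all_classical all_reals all_analysis.
From mathcomp Require Import measurable_realfun ring lra.
Import Order.TTheory GRing.Theory Num.Theory numFieldNormedType.Exports.
Local Open Scope classical_set_scope.
Local Open Scope ring_scope.

Set Implicit Arguments.
Unset Strict Implicit.
Unset Printing Implicit Defensive.

(** * N-functions, their complementary functions and chord slopes *)

Section NFunctionTheory.
Context {R : realType} (Phi : R -> R) (PhiN : N_function Phi).
Local Notation Psi := (compl_fun Phi).

Let Phi_cont : continuous Phi. Proof. by case: PhiN => -[]. Qed.
Let Phi_ge0 x : 0 <= Phi x. Proof. by case: PhiN => _ [] + _ _ _; apply. Qed.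
Let Phi0 : Phi 0 = 0. Proof. by case: PhiN => _ [_ H _ _]; apply/H. Qed.

(** Convexity with denominators cleared: the case [a = c] is allowed, and [lra] can use the result
    directly. *)
Lemma N_function_chord (a b c : R) : a <= b <= c ->
  (c - a) * Phi b <= (c - b) * Phi a + (b - a) * Phi c.
Proof.
move=> /andP[ab bc].
have [ac|] := ltP a c; last first.
  move=> ca; have -> : b = a by lra.
  by have -> : c = a; lra.
case: PhiN => -[_ _ cvx] _.
have ca0 : 0 < c - a by rewrite subr_gt0.
have /(cvx a c) : 0 <= (c - b) / (c - a) <= 1.
  by rewrite ler_pdivlMr// ler_pdivrMr// mul0r mul1r; lra.
rewrite (_ : _ * a + _ * c = b); last by field; rewrite gt_eqF.
move=> /(ler_wpM2l (ltW ca0)) /le_trans; apply.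
by rewrite le_eqVlt; apply/orP; left; apply/eqP; field; rewrite gt_eqF.
Qed.

(** Division by zero returns 0, which is the limit of [Phi x / x] at 0, so the ratio is continuous
    on the whole line. *)
Definition Nratio (x : R) : R := Phi x / x.

Lemma Nratio0 : Nratio 0 = 0.
Proof. by rewrite /Nratio invr0 mulr0. Qed.

Lemma NratioE x : Phi x = x * Nratio x.
Proof.
have [->|x0] := eqVneq x 0; first by rewrite mul0r Phi0.
by rewrite /Nratio; field.
Qed.

Lemma Nratio_continuous : continuous Nratio.
Proof.
move=> x; have [->|x0] := eqVneq x 0.
  by apply/continuous_withinNx; rewrite Nratio0; case: PhiN => _ [].
apply: cvgM; first exact: Phi_cont.
exact: cvgV.
Qed.

(** Since [Phi 0 = 0], the ratio is the slope of the chord from the origin, which increases by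
    convexity. *)
Lemma Nratio_homo (x y : R) : 0 <= x -> x <= y -> Nratio x <= Nratio y.
Proof.
rewrite le_eqVlt => /predU1P[<- y0|x0 xy].
  by rewrite Nratio0 divr_ge0.
have y0 : 0 < y by exact: lt_le_trans xy.
rewrite /Nratio ler_pdivrMr// mulrAC ler_pdivlMr//.
have := @N_function_chord 0 x y; rewrite (ltW x0) xy Phi0 => /(_ isT).
by rewrite !subr0 mulr0 add0r mulrC [Phi y * _]mulrC.
Qed.

Lemma Nratio_ge0 x : 0 <= x -> 0 <= Nratio x.
Proof. by move=> x0; rewrite -Nratio0 Nratio_homo. Qed.

Lemma Nratio_unbounded (M : R) :
  exists2 X, 0 < X & forall x, X <= x -> M <= Nratio x.
Proof.
case: PhiN => _ [_ _ _ /cvgryPge /(_ M)[N [_ NM]]].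
exists (Num.max (N + 1) 1); first by rewrite lt_max ltr01 orbT.
move=> x; rewrite ge_max => /andP[Nx _]; apply: NM.
by apply: lt_le_trans Nx; rewrite ltrDl.
Qed.

Lemma N_function_homo (x y : R) : 0 <= x -> x <= y -> Phi x <= Phi y.
Proof.
move=> x0 xy; rewrite !NratioE ler_pM ?Nratio_ge0//.
exact: Nratio_homo.
Qed.

(* Beyond the point where the ratio exceeds [M], the terms of the supremum
   are nonpositive, so only [x <= X] matters. *)
Lemma compl_fun_cutoff (M : R) : exists2 X, 0 < X &
  forall x y : R, 0 <= x -> `|y| <= M -> X < x -> x * `|y| - Phi x <= 0.
Proof.
have [X X0 XM] := Nratio_unbounded M; exists X => // x y x0 yM Xx.
rewrite subr_le0 NratioE ler_wpM2l// (le_trans yM)// XM//.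
exact: ltW.
Qed.

(** This makes [sup] a genuine supremum: up to the cutoff [X] the terms are at most [X |y|], and
    beyond it they are nonpositive. *)
Lemma compl_fun_has_sup (y : R) :
  has_sup [set x * `|y| - Phi x | x in [set x : R | 0 <= x]].
Proof.
split; first by exists (0 * `|y| - Phi 0), 0 => //=.
have [X X0 XM] := compl_fun_cutoff `|y|.
exists (X * `|y|) => _ [x /= x0 <-].
have [xX|xX] := leP x X.
  by rewrite (@le_trans _ _ (x * `|y|))// ?gerBl// ler_wpM2r.
by rewrite (le_trans (XM _ _ _ _ xX))// mulr_ge0// ltW.
Qed.

Lemma compl_fun_ub (x y : R) : 0 <= x -> x * `|y| - Phi x <= Psi y.
Proof.
by move=> x0; apply: ub_le_sup; [case: (compl_fun_has_sup y)|exists x].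
Qed.

Lemma compl_fun_le (y c : R) :
  (forall x : R, 0 <= x -> x * `|y| - Phi x <= c) -> Psi y <= c.
Proof.
move=> H; apply: ge_sup; first by case: (compl_fun_has_sup y).
by move=> _ [x /= x0 <-]; exact: H.
Qed.

Lemma N_function_young (x y : R) : 0 <= x -> x * `|y| <= Phi x + Psi y.
Proof. by move=> x0; have := @compl_fun_ub x y x0; lra. Qed.

Lemma compl_fun_ge0 y : 0 <= Psi y.
Proof. by have := @compl_fun_ub 0 y (lexx _); rewrite Phi0 mul0r subr0. Qed.

Lemma compl_fun_norm y : Psi `|y| = Psi y.
Proof. by rewrite /compl_fun normr_id. Qed.

Lemma compl_fun0 : Psi 0 = 0.
Proof.
apply/eqP; rewrite eq_le compl_fun_ge0 andbT.
by apply: compl_fun_le => x _; rewrite normr0 mulr0 add0r oppr_le0.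
Qed.

(** Termwise, [t * Phi x <= Phi x]. The inequality serves to shrink a test function until it
    satisfies the Orlicz constraint. *)
Lemma compl_fun_scale (t y : R) : 0 <= t -> t <= 1 -> Psi (t * y) <= t * Psi y.
Proof.
move=> t0 t1; apply: compl_fun_le => x x0.
have := ler_wpM2l t0 (@compl_fun_ub x y x0).
apply: le_trans; rewrite normrM (ger0_norm t0) mulrBr mulrCA lerB//.
by rewrite ler_piMl.
Qed.

(** For arguments bounded by [M] only [x <= X] matters, and each such term is Lipschitz in [y] with
    constant [X]. *)
Lemma compl_fun_lipschitz (M : R) : exists2 X, 0 < X &
  forall y z : R, `|y| <= M -> `|z| <= M -> Psi y <= Psi z + X * `|y - z|.
Proof.
have [X X0 XM] := compl_fun_cutoff M; exists X => // y z yM zM.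
apply: compl_fun_le => x x0; have [xX|xX] := leP x X.
  have := @compl_fun_ub x z x0.
  have := ler_wpM2r (normr_ge0 (y - z)) xX.
  have := ler_wpM2l x0 (lerB_dist y z).
  rewrite mulrBr; lra.
rewrite (le_trans (XM _ _ _ _ xX))// addr_ge0 ?compl_fun_ge0// mulr_ge0//.
exact: ltW.
Qed.

Lemma compl_fun_continuous : continuous Psi.
Proof.
move=> y; have [X X0 XM] := compl_fun_lipschitz (`|y| + 1).
apply/cvgrPdist_lt => e e0; near=> z.
(* The bound 1 keeps [z] in the range where [X] is a Lipschitz constant; the bound [e / X] gives the
   estimate. *)
have zy : `|y - z| < Num.min 1 (e / X).
  near: z; apply: cvgr_dist_lt => //.
  by rewrite lt_min ltr01 divr_gt0.
move: zy; rewrite lt_min => /andP[zy1 zy2].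
have zM : `|z| <= `|y| + 1.
  by have := lerB_dist z y; rewrite distrC in zy1 *; lra.
have yM : `|y| <= `|y| + 1 by rewrite lerDl.
rewrite ltr_pdivlMr// in zy2.
have := XM _ _ yM zM; have := XM _ _ zM yM; rewrite (distrC z y) => h1 h2.
by rewrite ltr_norml; apply/andP; split; lra.
Unshelve. all: by end_near. Qed.

(* The slope of the chord of [Phi] over [[x, (1 + eta) x]], written so that
   continuity at [0] is visible. *)
Definition Nslope (eta x : R) : R :=
  ((1 + eta) * Nratio ((1 + eta) * x) - Nratio x) / eta.

Section Slope.
Variable eta : R.
Hypothesis eta0 : 0 < eta.

Lemma Nslope0 : Nslope eta 0 = 0.
Proof. by rewrite /Nslope mulr0 Nratio0 mulr0 subrr mul0r. Qed.

Lemma Nslope_continuous : continuous (Nslope eta).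
Proof.
move=> x; apply: cvgM; last exact: cvg_cst.
apply: cvgB; last exact: Nratio_continuous.
apply: cvgM; first exact: cvg_cst.
apply: (@continuous_comp _ _ _ (fun z => (1 + eta) * z) Nratio).
  by apply: cvgM; [exact: cvg_cst|exact: cvg_id].
exact: Nratio_continuous.
Qed.

(** By monotonicity of the ratio, the numerator of the slope is at least [eta * Nratio x]. *)
Lemma Nslope_ge (x : R) : 0 <= x -> Nratio x <= Nslope eta x.
Proof.
move=> x0; rewrite /Nslope ler_pdivlMr//.
have xx : x <= (1 + eta) * x by rewrite ler_peMl// lerDl ltW.
have e1 : 0 <= 1 + eta by rewrite addr_ge0// ltW.
by have := ler_wpM2l e1 (Nratio_homo x0 xx); lra.
Qed.

Lemma Nslope_ge0 (x : R) : 0 <= x -> 0 <= Nslope eta x.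
Proof. by move=> x0; rewrite (le_trans (Nratio_ge0 x0))// Nslope_ge. Qed.

(* Equality in Young's inequality would hold at a point of the chord where the
   slope is a subgradient; the factor [1 + eta] pays for not being there. *)
Lemma Nslope_young (x : R) : 0 <= x ->
  Phi x + Psi (Nslope eta x) <= (1 + eta) * (x * Nslope eta x).
Proof.
move=> x0; have s0 := Nslope_ge0 x0.
rewrite -lerBrDl; apply: compl_fun_le => z z0; rewrite (ger0_norm s0).
move: x0; rewrite le_eqVlt => /predU1P[xE|x0].
  by rewrite -xE Nslope0 Phi0 !(mulr0, mul0r) !add0r oppr0 oppr_le0.
set y := (1 + eta) * x; set s := Nslope eta x in s0 *.
have yx : y - x = eta * x by rewrite /y; lra.
have yx0 : 0 < y - x by rewrite yx mulr_gt0.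
have sE : s * (y - x) = Phi y - Phi x.
  by rewrite yx /s /Nslope !NratioE -/y /y; field; rewrite gt_eqF.
rewrite mulrA -/y.
have xs : x * s <= y * s by rewrite ler_wpM2r//; lra.
have chordE : (y - x) * (x * s - Phi x) = x * (Phi y - Phi x) - (y - x) * Phi x.
  by rewrite -sE; ring.
have chordz : (y - x) * (z * s - Phi z) = z * (Phi y - Phi x) - (y - x) * Phi z.
  by rewrite -sE; ring.
(* Outside [[x, y]] the graph of [Phi] lies above the chord line, so the term at [z] is at most the
   term at [x]. Inside, [z * s <= y * s] and [Phi x <= Phi z] suffice. *)
have [zx|xz] := leP z x.
  apply: (@le_trans _ _ (x * s - Phi x)); last by rewrite lerB.
  rewrite -(ler_pM2l yx0) chordE chordz.
  have /N_function_chord : z <= x <= y by rewrite zx/=; lra.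
  lra.
have [zy|yz] := leP z y.
  rewrite lerB ?ler_wpM2r// N_function_homo//; exact: ltW.
apply: (@le_trans _ _ (x * s - Phi x)); last by rewrite lerB.
rewrite -(ler_pM2l yx0) chordE chordz.
have /N_function_chord : x <= y <= z by rewrite (ltW yz) andbT; lra.
lra.
Qed.
End Slope.

(** The term at 1 of the supremum gives [Psi s >= s - Phi 1], and the slope dominates the ratio,
    which is large once [a * x >= X]. *)
Lemma compl_Nslope_large (c M : R) : 0 < c -> exists2 a, 0 < a &
  forall eta x : R, 0 < eta -> c <= x -> M <= Psi (Nslope eta (a * x)).
Proof.
move=> c0; have [X X0 XM] := Nratio_unbounded (M + Phi 1).
exists (X / c) => [|eta x eta0 cx]; first by rewrite divr_gt0.
have Xx : X <= X / c * x by rewrite mulrAC ler_pdivlMr// ler_wpM2l// ltW.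
have ax0 : 0 <= X / c * x by rewrite (le_trans _ Xx)// ltW.
have := @compl_fun_ub 1 (Nslope eta (X / c * x)) ler01.
have := XM _ Xx; have := Nslope_ge eta0 ax0; have := ler_norm (Nslope eta (X / c * x)).
lra.
Qed.

End NFunctionTheory.

(** * Integration of compactly supported continuous functions, and the support of a Radon measure *)

Section CompactSupport.
Context {R : realType} {T : ptopologicalType}.
Implicit Types (f : T -> R) (mu : {measure set (borel T) -> \bar R}).

Lemma open_borel (U : set T) : open U -> measurable (U : set (borel T)).
Proof. exact: sub_sigma_algebra. Qed.

Lemma closed_borel (A : set T) : closed A -> measurable (A : set (borel T)).
Proof. by move/closed_openC/open_borel/measurableC; rewrite setCK. Qed.

Lemma continuous_borel_measurable f :
  continuous f -> measurable_fun [set: borel T] f.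
Proof.
move=> /continuousP cf; apply: (measurability _ (RGenOpens.measurableE R)).
move=> _ [_ [a [b ->] <-]]; rewrite setTI.
by apply: open_borel; apply: cf; exact: interval_open.
Qed.

Lemma Cc_comp f (H : R -> R) : continuous H -> H 0 = 0 -> Cc f ->
  Cc (fun x => H (f x)).
Proof.
move=> cH H0 [cf Kf]; split.
  by move=> x; apply: continuous_comp; [exact: cf|exact: cH].
apply: (subclosed_compact _ Kf); first exact: closed_closure.
apply: closureS => x /=; apply: contra_neq => ->; exact: H0.
Qed.

Lemma Cc_normM f (h : T -> R) : Cc f -> continuous h ->
  Cc (fun x => `|f x * h x|).
Proof.
move=> [cf Kf] ch; split.
  by move=> x; apply: cvg_norm; apply: cvgM; [exact: cf|exact: ch].
apply: (subclosed_compact _ Kf); first exact: closed_closure.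
by apply: closureS => x /=; apply: contra_neq => ->; rewrite mul0r normr0.
Qed.

Lemma Cc_bounded f : Cc f -> exists2 M, 0 < M & forall x, `|f x| <= M.
Proof.
move=> [cf Kf].
have : compact (f @` closure [set x | f x != 0]).
  by apply: continuous_compact => //; exact: continuous_subspaceT.
move=> /compact_bounded[M [_ MP]].
exists (Num.max (M + 1) 1) => [|x]; first by rewrite lt_max ltr01 orbT.
have [->|fx0] := eqVneq (f x) 0.
  by rewrite normr0 le_max ler01 orbT.
apply: (MP (Num.max (M + 1) 1)); first by rewrite lt_max ltrDl ltr01.
by exists x => //; exact: subset_closure.
Qed.

(** Used to replace integrals over the whole space by integrals over a compact set, which has finite
    measure. *)
Lemma patch_Cc_support f (g : T -> R) :
  (forall x, f x = 0 -> g x = 0) -> g \_ (closure [set x | f x != 0]) = g.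
Proof.
move=> g0; apply/funext => x; rewrite patchE; case: ifPn => //.
rewrite notin_setE => xK; rewrite g0//; apply: contrapT => /eqP fx0.
by apply: xK; exact: subset_closure.
Qed.

Section FiniteOnCompacts.
Variable mu : {measure set (borel T) -> \bar R}.
Hypothesis muK : forall K : set T, compact K -> (mu K < +oo)%E.

Lemma Cc_integrable f : Cc f -> mu.-integrable [set: borel T] (EFin \o f).
Proof.
move=> Cf; have [M M0 fM] := Cc_bounded Cf.
have [cf Kf] := Cf.
set K := closure _ in Kf.
have mK : measurable (K : set (borel T)) by apply: closed_borel; exact: closed_closure.
have -> : EFin \o f = (EFin \o f) \_ K.
  by apply/funext => x; rewrite restrict_EFin/= (@patch_Cc_support f f).
apply/(integrable_mkcond _ mK)/measurable_bounded_integrable => //.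
- exact: muK.
- by apply: measurable_funTS; exact: continuous_borel_measurable.
- exists M; split; first exact: num_real.
  by move=> y My x _; apply: le_trans (fM x) (ltW My).
Qed.

Lemma Cc_EFin_Rintegral f : Cc f ->
  (\int[mu]_x (f x)%:E = (\int[mu]_x f x)%R%:E)%E.
Proof.
move=> Cf; rewrite /Rintegral fineK//.
by apply: integrable_fin_num; [exact: measurableT|exact: Cc_integrable].
Qed.

(** Dominated convergence on the compact support of [f], with a constant dominating function for
    parameters within 1 of [a]. *)
Lemma Cc_dilation_continuous f (H : R -> R) : continuous H -> H 0 = 0 -> Cc f ->
  continuous (fun a : R => (\int[mu]_x H (a * f x))%R).
Proof.
move=> cH H0 Cf a; have [M M0 fM] := Cc_bounded Cf; have [cf Kf] := Cf.
set K := closure _ in Kf.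
have mK : measurable (K : set (borel T)) by apply: closed_borel; exact: closed_closure.
have CH b : Cc (fun x => H (b * f x)).
  apply: (@Cc_comp f (fun y => H (b * y))) => //; last by rewrite mulr0.
  move=> y; apply: continuous_comp; last exact: cH.
  by apply: cvgM; [exact: cvg_cst|exact: cvg_id].
have -> : (fun b : R => (\int[mu]_x H (b * f x))%R) =
          (fun b => (\int[mu]_(x in K) H (b * f x))%R).
  apply/funext => b; rewrite [RHS]Rintegral_mkcond patch_Cc_support// => x ->.
  by rewrite mulr0.
(* For [b] within 1 of [a], the values [b * f x] stay in [[- A, A]], where [H] is bounded. *)
pose A := (`|a| + 1) * M.
have : compact (H @` `[- A, A]).
  by apply: continuous_compact; [exact: continuous_subspaceT|exact: segment_compact].
move=> /compact_bounded[B [_ BP]].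
apply: (@continuity_under_integral _ _ _ mu (fun b x => H (b * f x)) K mK
  (a - 1) (a + 1) _ _ (cst (B + 1))).
- move=> b _; apply: integrableS (Cc_integrable (CH b)) => //; exact: measurableT.
- apply: aeW => x _ b _; apply: continuous_comp; last exact: cH.
  by apply: cvgM; [exact: cvg_id|exact: cvg_cst].
- apply: measurable_bounded_integrable => //; first exact: muK.
  exists `|B + 1|; split; first exact: num_real.
  by move=> y By x _; exact: ltW.
- move=> b /=; rewrite in_itv/= => /andP[ab ba]; apply: aeW => x _.
  apply: BP; first by rewrite ltrDl.
  exists (b * f x) => //=; rewrite in_itv/= -ler_norml normrM /A ler_pM//.
  have -> : b = a + (b - a) by ring.
  rewrite (le_trans (ler_normD _ _))// lerD2l ler_norml; lra.
- by rewrite inE/= in_itv/=; apply/andP; split; lra.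
Qed.

End FiniteOnCompacts.

(** By inner regularity on open sets it suffices to treat compact subsets of the complement;
    finitely many null open sets cover each of them. *)
Lemma radon_setC_msupport mu : hausdorff_space T -> radon mu ->
  closed (msupport mu) -> mu (~` msupport mu) = 0%E.
Proof.
move=> hT [_ _ mu_open] clS.
have oU : open (~` msupport mu) by exact: closed_openC.
rewrite mu_open//; apply/eqP; rewrite eq_le; apply/andP; split; last first.
  apply: ereal_sup_ubound; exists set0 => //=; split; first exact: compact0.
  exact: sub0set.
apply: ge_ereal_sup => _ [K [cK KU] <-].
(* Each point off the support gets a null open neighbourhood; on the support the value of [V] is a
   dummy. *)
have /choice[V VP] : forall x, exists V : set T,
    ~ msupport mu x -> [/\ open V, V x & mu V = 0%E].
  move=> x; have [Sx|nSx] := pselect (msupport mu x); first by exists set0.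
  move/existsNP : nSx => [V /not_implyP[oV /not_implyP[Vx mV]]].
  exists V => _; split => //; apply/eqP; rewrite -measure_le0 leNgt.
  exact/negP.
rewrite compact_cover in cK.
have [|x Kx|D DS KD] := cK _ (~` msupport mu) V.
- by move=> x /VP[].
- by exists x; [exact: KU|have [] := VP _ (KU _ Kx)].
have : mu.-negligible (K : set (borel T)).
  apply: (@negligibleS _ (borel T) _ mu _ _ KD); rewrite /cover bigcup_fset.
  rewrite big_seq; elim/big_ind : _ => //.
  - exact: negligible_set0.
  - by move=> A B; exact: negligibleU.
  - move=> x xD; have /VP[oV _ V0] : ~ msupport mu x.
      by move/DS : xD; rewrite inE.
    by exists (V x); split => //; exact: open_borel.
rewrite -compact_cover in cK.
rewrite negligibleP => [->//|].
by apply: closed_borel; exact: compact_closed.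
Qed.

End CompactSupport.

(** * Two-sided bounds for the Orlicz norm over a conull set *)

Section OrliczNorm.
Context {R : realType} {T : ptopologicalType}.
Variables (Phi : R -> R) (mu : {measure set (borel T) -> \bar R}) (D : set T).
Hypothesis PhiN : N_function Phi.
Hypothesis muK : forall K : set T, compact K -> (mu K < +oo)%E.
Hypothesis mD : measurable (D : set (borel T)).
Hypothesis muD : mu (~` D) = 0%E.
Local Notation Psi := (compl_fun Phi).
Implicit Types f h : T -> R.

(** The norm integrates over the fiber [D], while the continuity axiom of a Haar system concerns
    integrals over the whole space; this passes between them. *)
Lemma ge0_integral_conull (g : borel T -> \bar R) :
  measurable_fun [set: borel T] g -> (forall x, 0 <= g x)%E ->
  (\int[mu]_(x in D) g x = \int[mu]_x g x)%E.
Proof.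
move=> mg g0.
rewrite [RHS](@ge0_negligible_integral _ _ _ mu setT (~` D))//.
- by rewrite setTD setCK.
- exact: measurableC.
Qed.

Lemma Cc_integral_conull f : Cc f -> (forall x, 0 <= f x) ->
  (\int[mu]_(x in D) (f x)%:E = (\int[mu]_x f x)%R%:E)%E.
Proof.
move=> Cf f0; rewrite ge0_integral_conull ?Cc_EFin_Rintegral//.
by apply/measurable_EFinP; apply: continuous_borel_measurable; case: Cf.
Qed.

Lemma orlicz_norm_ge0 f : (0 <= orlicz_norm Psi mu D f)%E.
Proof.
apply: le_ereal_sup_tmp; exists 0%E => //=; exists (cst 0); last first.
  by rewrite integral0_eq// => x _; rewrite mulr0 normr0.
split; first exact: measurable_cst.
by rewrite integral0_eq// => x _; rewrite normr0 compl_fun0.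
Qed.

Lemma Cc_dilation f (H : R -> R) (a : R) : continuous H -> H 0 = 0 -> Cc f ->
  Cc (fun x => H (a * `|f x|)).
Proof.
move=> cH H0; apply: (@Cc_comp _ _ f (fun y => H (a * `|y|))).
  move=> y; apply: continuous_comp; last exact: cH.
  by apply: cvgM; [exact: cvg_cst|exact: norm_continuous].
by rewrite normr0 mulr0.
Qed.

Lemma Cc_N_function f (a : R) : Cc f -> Cc (fun x => Phi (a * `|f x|)).
Proof.
case: PhiN => -[cPhi _ _] [_ Phi0 _ _].
by apply: Cc_dilation => //; exact/Phi0.
Qed.

(** Young's inequality for [a |f|] and [|k|] is divided by [a] and integrated, the integral of
    [Psi |k|] being at most 1. *)
Lemma orlicz_norm_le f (a : R) : Cc f -> 0 < a ->
  (orlicz_norm Psi mu D f <=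
   ((1 + \int[mu]_x Phi (a * `|f x|)) / a)%R%:E)%E.
Proof.
move=> Cf a0; have [cf Kf] := Cf.
have Phi_ge0 x : 0 <= Phi x by case: PhiN => _ [].
apply: ge_ereal_sup => _ [k [mk Psik] <-].
have mPsik : measurable_fun (D : set (borel T)) (fun x => (Psi `|k x|)%:E).
  apply/measurable_EFinP; apply: measurableT_comp.
    by apply: continuous_measurable_fun; exact: compl_fun_continuous.
  exact: measurableT_comp.
have mPhif : measurable_fun (D : set (borel T)) (fun x => (Phi (a * `|f x|))%:E).
  apply/measurable_EFinP; apply: measurable_funTS.
  by apply: continuous_borel_measurable; case: (Cc_N_function a Cf).
have mfk : measurable_fun (D : set (borel T)) (fun x => f x * k x).
  apply: measurable_funM => //; apply: measurable_funTS.
  exact: continuous_borel_measurable.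
apply: (@le_trans _ _ (\int[mu]_(x in D)
    (a^-1%:E * ((Phi (a * `|f x|))%:E + (Psi `|k x|)%:E)))%E).
  apply: ge0_le_integral => //.
  - by apply/measurable_EFinP; exact: measurableT_comp.
  - by apply: measurable_funeM; exact: emeasurable_funD.
  - move=> x _; rewrite -EFinD -EFinM lee_fin ler_pdivlMl//.
    have := N_function_young PhiN (k x) (mulr_ge0 (ltW a0) (normr_ge0 (f x))).
    rewrite normrM mulrA => /le_trans; apply; rewrite lerD2l.
    by rewrite compl_fun_norm.
rewrite ge0_integralZl//; last 3 first.
- exact: emeasurable_funD.
- by move=> x _; rewrite adde_ge0 ?lee_fin ?compl_fun_ge0.
- by rewrite lee_fin invr_ge0 ltW.
rewrite ge0_integralD//; last 2 first.
- by move=> x _; rewrite lee_fin.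
- by move=> x _; rewrite lee_fin compl_fun_ge0.
rewrite (Cc_integral_conull (Cc_N_function a Cf))//.
rewrite mulrC EFinM lee_pmul2l ?lte_fin ?invr_gt0// EFinD addeC.
exact: leeD2r.
Qed.

Lemma orlicz_norm_fin_num f : Cc f -> orlicz_norm Psi mu D f \is a fin_num.
Proof.
move=> Cf; rewrite ge0_fin_numE ?orlicz_norm_ge0//.
by apply: le_lt_trans (orlicz_norm_le Cf ltr01) _; rewrite ltry.
Qed.

(** The test function is [h / c], admissible by [compl_fun_scale]. *)
Lemma orlicz_norm_ge f h (c : R) : Cc f -> Cc h -> 1 <= c ->
  \int[mu]_x Psi (h x) <= c ->
  (((\int[mu]_x `|f x * h x|) / c)%:E <= orlicz_norm Psi mu D f)%E.
Proof.
move=> Cf Ch c1 hc; have c0 : 0 < c by exact: lt_le_trans c1.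
have c'1 : c^-1 <= 1 by rewrite invf_le1.
have [cf _] := Cf; have [ch _] := Ch.
have CPsi : Cc (fun x => Psi (h x)).
  apply: Cc_comp => //; [exact: compl_fun_continuous|exact: compl_fun0].
have Cfh := Cc_normM Cf ch.
have mh : measurable_fun (D : set (borel T)) (fun x => c^-1 * h x).
  apply: measurable_funM; first exact: measurable_cst.
  by apply: measurable_funTS; exact: continuous_borel_measurable.
apply: ereal_sup_ubound; exists (fun x => c^-1 * h x).
  split => //.
  apply: (@le_trans _ _ (\int[mu]_(x in D) (c^-1%:E * (Psi (h x))%:E))%E).
    apply: ge0_le_integral => //.
    - by move=> x _; rewrite lee_fin compl_fun_ge0.
    - apply/measurable_EFinP; apply: measurableT_comp.
        by apply: continuous_measurable_fun; exact: compl_fun_continuous.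
      exact: measurableT_comp.
    - apply: measurable_funeM; apply/measurable_EFinP; apply: measurable_funTS.
      by apply: continuous_borel_measurable; case: CPsi.
    - move=> x _; rewrite -EFinM lee_fin.
      have := compl_fun_scale PhiN (h x) _ c'1; rewrite invr_ge0 (ltW c0).
      by rewrite compl_fun_norm; exact.
  rewrite ge0_integralZl//; last 3 first.
  - apply/measurable_EFinP; apply: measurable_funTS.
    by apply: continuous_borel_measurable; case: CPsi.
  - by move=> x _; rewrite lee_fin compl_fun_ge0.
  - by rewrite lee_fin invr_ge0 ltW.
  rewrite Cc_integral_conull//; last by move=> x; exact: compl_fun_ge0.
  by rewrite -EFinM lee_fin ler_pdivrMl// mulr1.
have E x : (`|f x * (c^-1 * h x)|%:E = c^-1%:E * `|f x * h x|%:E)%E.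
  by rewrite -EFinM mulrCA normrM gtr0_norm ?invr_gt0.
under eq_integral do rewrite E.
rewrite ge0_integralZl//; last 2 first.
- apply/measurable_EFinP; apply: measurable_funTS.
  by apply: continuous_borel_measurable; case: Cfh.
- by rewrite lee_fin invr_ge0 ltW.
by rewrite Cc_integral_conull// -EFinM mulrC.
Qed.

(* Near-optimal dual pair: Young's inequality for [a |f|] and [h] is an equality
   up to the factor [1 + eta], and [h] saturates the constraint. *)
Lemma exists_Nslope_saturated f (eta : R) (U : set T) (c : R) :
  Cc f -> 0 < eta -> open U -> (0 < mu U)%E -> 0 < c ->
  (forall x, U x -> c <= `|f x|) ->
  exists2 a, 0 < a & \int[mu]_x Psi (Nslope Phi eta (a * `|f x|)) = 1.
Proof.
move=> Cf eta0 oU muU c0 fU.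
pose H y := Psi (Nslope Phi eta y).
have cH : continuous H.
  move=> y; apply: continuous_comp.
    exact: Nslope_continuous.
  exact: compl_fun_continuous.
have H0 : H 0 = 0 by rewrite /H Nslope0 compl_fun0.
have Cnf : Cc (fun x => `|f x|).
  by apply: Cc_comp => //; [exact: norm_continuous|exact: normr0].
pose J (a : R) := \int[mu]_x H (a * `|f x|).
have cJ : continuous J by exact: Cc_dilation_continuous.
have mU : measurable (U : set (borel T)) by exact: open_borel.
(* [U] lies in the compact support of [f]. *)
have muUfin : mu U \is a fin_num.
  rewrite ge0_fin_numE//; apply: le_lt_trans (muK (proj2 Cf)).
  apply: le_measure; rewrite ?inE//.
    by apply: closed_borel; exact: closed_closure.
  move=> x Ux; apply: subset_closure => /=; rewrite -normr_gt0.
  exact: lt_le_trans (fU _ Ux).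
have m0 : 0 < fine (mu U) by rewrite fine_gt0// muU/= -ge0_fin_numE.
(* At [A] the integrand is at least [1 / mu U] on [U], so its integral reaches 1. *)
have [A A0 AP] := compl_Nslope_large PhiN (fine (mu U))^-1 c0.
have J1 : 1 <= J A.
  rewrite -lee_fin -(Cc_EFin_Rintegral muK); last exact: Cc_dilation.
  apply: (@le_trans _ _ (\int[mu]_(x in U) ((fine (mu U))^-1)%:E)%E).
    rewrite integral_cst// -[X in (_ * X)%E]fineK// -EFinM mulVf// gt_eqF//.
  apply: (@le_trans _ _ (\int[mu]_(x in U) (H (A * `|f x|))%:E)%E).
    apply: ge0_le_integral => //.
    - apply/measurable_EFinP; apply: measurable_funTS.
      by apply: continuous_borel_measurable; case: (Cc_dilation A cH H0 Cf).
    - by move=> x Ux; rewrite lee_fin; exact: AP (fU _ Ux).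
  apply: ge0_subset_integral => //.
  - apply/measurable_EFinP.
    by apply: continuous_borel_measurable; case: (Cc_dilation A cH H0 Cf).
  - by move=> x _; rewrite lee_fin compl_fun_ge0.
have J0 : J 0 = 0.
  by rewrite /J /Rintegral integral0_eq// => x _; rewrite mul0r H0.
have [||a + Ja] := @IVT R J 0 A 1 (ltW A0).
- exact: continuous_subspaceT.
- by rewrite J0 ge_min ler01/= le_max J1 orbT.
rewrite in_itv/= => /andP[a0 _]; exists a => //.
rewrite lt_neqAle a0 andbT; apply/eqP => a0E.
by move: Ja; rewrite -a0E J0 => /esym/eqP; rewrite oner_eq0.
Qed.

(** This is [Nslope_young] at [a |f x|], integrated and divided by [a]. *)
Lemma Nslope_duality f (eta a : R) : Cc f -> 0 < eta -> 0 < a ->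
  let h := fun x => Nslope Phi eta (a * `|f x|) in
  \int[mu]_x Psi (h x) = 1 ->
  (1 + \int[mu]_x Phi (a * `|f x|)) / a <=
  (1 + eta) * \int[mu]_x `|f x * h x|.
Proof.
move=> Cf eta0 a0 h J1.
have ax0 x : 0 <= a * `|f x| by rewrite mulr_ge0// ltW.
have Ch : Cc h.
  by apply: Cc_dilation => //; [exact: Nslope_continuous|exact: Nslope0].
have cPsi := compl_fun_continuous PhiN.
have CPsi : Cc (fun x => Psi (h x)) by apply: Cc_comp => //; exact: compl_fun0.
have [[cPhi _ _] [_ Phi0 _ _]] := PhiN.
have CPhi := Cc_N_function a Cf.
have can : continuous (fun y : R => a * `|y|).
  by move=> y; apply: cvgM; [exact: cvg_cst|exact: norm_continuous].
have csl : continuous (fun y : R => Nslope Phi eta (a * `|y|)).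
  move=> y; apply: (@continuous_comp _ _ _ (fun y => a * `|y|)); first exact: can.
  exact: Nslope_continuous.
(* Writing [a |f h|] as a function of [f] alone lets [Cc_comp] supply integrability. *)
pose S (y : R) := a * `|y| * Nslope Phi eta (a * `|y|).
have fhE x : `|f x * h x| = a^-1 * S (f x).
  rewrite /S normrM (ger0_norm (Nslope_ge0 PhiN eta0 (ax0 x))).
  by rewrite !mulrA mulVf ?mul1r// gt_eqF.
have CS : Cc (fun x => S (f x)).
  apply: Cc_comp => //; last by rewrite /S normr0 mulr0 mul0r.
  by move=> y; apply: cvgM; [exact: can|exact: csl].
have CeS : Cc (fun x => (1 + eta) * S (f x)).
  apply: (@Cc_comp _ _ _ ( *%R (1 + eta))) => //; last by rewrite mulr0.
  by move=> y; apply: cvgM; [exact: cvg_cst|exact: cvg_id].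
have CL : Cc (fun x => Phi (a * `|f x|) + Psi (h x)).
  apply: (@Cc_comp _ _ f (fun y => Phi (a * `|y|) +
    Psi (Nslope Phi eta (a * `|y|)))) => //; last first.
    by rewrite normr0 mulr0 Nslope0 compl_fun0// addr0; exact/Phi0.
  move=> y; apply: cvgD.
    by apply: (@continuous_comp _ _ _ (fun y => a * `|y|)); [exact: can|exact: cPhi].
  apply: (@continuous_comp _ _ _ (fun y => Nslope Phi eta (a * `|y|))).
    exact: csl.
  exact: cPsi.
have mT := @measurableT _ (borel T).
under [in leRHS]eq_Rintegral do rewrite fhE.
rewrite RintegralZl//; last exact: Cc_integrable.
rewrite ler_pdivrMr//.
rewrite [leRHS](_ : _ = (1 + eta) * \int[mu]_x S (f x)); last first.
  by field; rewrite gt_eqF.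
rewrite -RintegralZl//; last exact: Cc_integrable.
(* Saturation turns the constant 1 into the integral of [Psi (h x)], so that the inequality becomes
   pointwise. *)
rewrite -[X in X + _ <= _]J1 addrC -RintegralD//; [|exact: Cc_integrable|exact: Cc_integrable].
apply: le_Rintegral => //.
- exact: (Cc_integrable muK CL).
- exact: (Cc_integrable muK CeS).
by move=> x _; exact: Nslope_young.
Qed.

End OrliczNorm.
(** A squeeze whose bounds may depend on [e] and need only have limits within [e] of [l]. *)
Lemma cvg_sandwich_eps {R : realType} {I : Type} (F : set_system I)
    {FF : Filter F} (g : I -> R) (l : R) :
  (forall e, 0 < e -> exists P Q : I -> R, exists p q : R,
     [/\ P x @[x --> F] --> p, Q x @[x --> F] --> q, p <= l + e, l - e <= q &
         \forall x \near F, Q x <= g x <= P x]) ->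
  g x @[x --> F] --> l.
Proof.
move=> H; apply/cvgrPdist_lt => e e0.
have e20 : 0 < e / 2 by rewrite divr_gt0.
have [P [Q [p [q [Pp Qq pl lq near_g]]]]] := H _ e20.
near=> x.
have : `|p - P x| < e / 2 by near: x; exact: cvgr_dist_lt.
have : `|q - Q x| < e / 2 by near: x; exact: cvgr_dist_lt.
have /andP[gQ gP] : Q x <= g x <= P x by near: x.
rewrite !ltr_norml => /andP[? ?] /andP[? ?]; apply/andP; split; lra.
Unshelve. all: by end_near. Qed.

(** * Fibers of the groupoid and the Haar system *)

Section GroupoidOrlicz.
Context {R : realType} {T : ptopologicalType}.
Variables (G2 : set (T * T)) (mul : T -> T -> T) (inv : T -> T).
Variable lam : T -> {measure set (borel T) -> \bar R}.
Hypothesis hT : hausdorff_space T.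
Hypothesis topG : top_groupoid G2 mul inv.
Hypothesis haarG : haar_system G2 mul inv lam.
Local Notation rng := (rng mul inv).
Local Notation units := (units mul inv).
Local Notation fiber := (fiber mul inv).

(** Multiplication is continuous only within [G2], but [y |-> (y, inv y)] takes all its values
    there. *)
Lemma rng_continuous : continuous rng.
Proof.
case: topG => -[_ _ G2inv _] cinv /subspace_continuousP cmul x W.
move=> /(cmul (x, inv x) (G2inv x)) W'.
have /(_ _ W') : (y, inv y) @[y --> x] --> (x, inv x).
  by apply: cvg_pair; [exact: cvg_id|exact: cinv].
by apply: (@filterS _ (nbhs x)) => y /=; apply; exact: G2inv.
Qed.

Lemma fiber_closed u : closed (fiber u).
Proof.
have -> : fiber u = rng @^-1` [set u] by [].
have /continuous_closedP := rng_continuous; apply.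
by apply: accessible_closed_set1; exact: hausdorff_accessible.
Qed.

Lemma fiber_measurable u : measurable (fiber u : set (borel T)).
Proof. by apply: closed_borel; exact: fiber_closed. Qed.

Lemma haar_compact_lty u : units u ->
  forall K : set T, compact K -> (lam u K < +oo)%E.
Proof. by case: haarG => + _ _ => /[apply] -[[]]. Qed.

Lemma haar_setC_fiber u : units u -> lam u (~` fiber u) = 0%E.
Proof.
case: haarG => + _ _ => /[apply] -[rad suppE].
by rewrite -suppE radon_setC_msupport// suppE; exact: fiber_closed.
Qed.

(** The axiom speaks of extended real integrals; the one at [u0] is finite, so [fine] preserves the
    limit. *)
Lemma haar_Rintegral_cvg (phi : T -> R) (u0 : T) : Cc phi -> units u0 ->
  \int[lam u]_x phi x @[u --> within units (nbhs u0)] --> \int[lam u0]_x phi x.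
Proof.
move=> Cphi Uu0; case: haarG => _ /(_ _ Cphi) /subspace_continuousP + _.
move=> /(_ _ Uu0) cphi; apply: fine_cvg.
by rewrite -(Cc_EFin_Rintegral (haar_compact_lty Uu0)).
Qed.

(** * Continuity and compact support of the norm along the fibers *)

Section Norm.
Variables (Phi : R -> R) (f : T -> R).
Hypothesis PhiN : N_function Phi.
Hypothesis Cf : Cc f.

(** At a unit the norm is finite by [orlicz_norm_fin_num], so [fine] loses nothing. *)
Definition fiber_norm (u : T) : R :=
  fine (orlicz_norm (compl_fun Phi) (lam u) (fiber u) f).

Lemma fiber_norm_ge0 u : 0 <= fiber_norm u.
Proof. by apply: fine_ge0; exact: orlicz_norm_ge0. Qed.

Lemma fiber_norm_le u (a : R) : units u -> 0 < a ->
  fiber_norm u <= (1 + \int[lam u]_x Phi (a * `|f x|)) / a.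
Proof.
move=> Uu a0; have muK := haar_compact_lty Uu.
have mD := fiber_measurable u; have muD := haar_setC_fiber Uu.
by rewrite -lee_fin fineK ?orlicz_norm_fin_num ?orlicz_norm_le.
Qed.

Lemma fiber_norm_ge u (h : T -> R) (c : R) : units u -> Cc h -> 1 <= c ->
  \int[lam u]_x compl_fun Phi (h x) <= c ->
  (\int[lam u]_x `|f x * h x|) / c <= fiber_norm u.
Proof.
move=> Uu Ch c1 hc; have muK := haar_compact_lty Uu.
have mD := fiber_measurable u; have muD := haar_setC_fiber Uu.
by rewrite -lee_fin fineK ?orlicz_norm_fin_num ?orlicz_norm_ge.
Qed.

Let Phi0 : Phi 0 = 0. Proof. by case: PhiN => _ [_ H _ _]; apply/H. Qed.

Let P (a : R) u := (1 + \int[lam u]_x Phi (a * `|f x|)) / a.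

Let P_cvg a u0 : units u0 -> P a u @[u --> within units (nbhs u0)] --> P a u0.
Proof.
move=> Uu0; apply: cvgM; last exact: cvg_cst.
apply: cvgD; first exact: cvg_cst.
by apply: haar_Rintegral_cvg => //; exact: Cc_N_function.
Qed.

Lemma fiber_norm_cvg0 u0 : units u0 -> (forall x, fiber u0 x -> f x = 0) ->
  fiber_norm u @[u --> within units (nbhs u0)] --> fiber_norm u0.
Proof.
move=> Uu0 f0; apply: cvg_sandwich_eps => e e0.
have e'0 : 0 < e^-1 by rewrite invr_gt0.
(* The integral vanishes because [f] is zero on the conull fiber, so [P a u0] is [1 / a]. *)
have PE : P e^-1 u0 = e.
  rewrite /P -[X in 1 + X]/(fine (\int[lam u0]_x (Phi (e^-1 * `|f x|))%:E)%E).
  rewrite -(ge0_integral_conull (fiber_measurable u0) (haar_setC_fiber Uu0)).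
  - by rewrite integral0_eq ?addr0 ?mul1r ?invrK// => x /f0->; rewrite normr0 mulr0 Phi0.
  - apply/measurable_EFinP; apply: continuous_borel_measurable.
    by case: (Cc_N_function PhiN e^-1 Cf).
  - by move=> x; rewrite lee_fin; case: PhiN => _ [].
exists (P e^-1), (cst 0), e, 0; split.
- by rewrite -{2}PE; exact: P_cvg.
- exact: cvg_cst.
- by rewrite lerDr fiber_norm_ge0.
- by rewrite subr_le0 -[leRHS]PE; exact: fiber_norm_le.
- by rewrite near_withinE; apply: nearW => u Uu; rewrite fiber_norm_ge0/=; exact: fiber_norm_le.
Qed.

Lemma fiber_norm_cvg u0 x0 : units u0 -> fiber u0 x0 -> f x0 != 0 ->
  fiber_norm u @[u --> within units (nbhs u0)] --> fiber_norm u0.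
Proof.
move=> Uu0 ux0 fx0; apply: cvg_sandwich_eps => e e0.
set l := fiber_norm u0; have l0 : 0 <= l := fiber_norm_ge0 u0.
(* This gives [eta * l <= e]; the added 1 keeps the denominator positive. *)
pose eta := e / (l + 1).
have l10 : 0 < l + 1 by rewrite ltr_wpDl.
have eta0 : 0 < eta by rewrite divr_gt0.
have etal : eta * l <= e.
  by rewrite /eta mulrAC ler_pdivrMr// ler_pM2l// lerDl.
have [cf _] := Cf.
pose c := `|f x0| / 2.
have c0 : 0 < c by rewrite divr_gt0// normr_gt0.
pose U := [set x | c < `|f x|].
have oU : open U.
  apply: (@open_comp _ _ (fun x => `|f x|) [set y | c < y]).
    by move=> x _; apply: cvg_norm; exact: cf.
  exact: open_gt.
have muU : (0 < lam u0 U)%E.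
  case: haarG => /(_ _ Uu0)[_ suppE] _ _.
  move: ux0; rewrite -suppE; apply => //.
  by rewrite /U /= /c ltr_pdivrMr// mulr_natr mulr2n ltrDl normr_gt0.
have muK := haar_compact_lty Uu0.
have [a a0 Ja] := exists_Nslope_saturated PhiN muK Cf eta0 oU muU c0
  (fun x Ux => ltW Ux).
pose h x := Nslope Phi eta (a * `|f x|).
have dual := Nslope_duality PhiN muK Cf eta0 a0 Ja.
have Ch : Cc h.
  by apply: Cc_dilation => //; [exact: Nslope_continuous|exact: Nslope0].
have CPsi : Cc (fun x => compl_fun Phi (h x)).
  by apply: Cc_comp => //; [exact: compl_fun_continuous|exact: compl_fun0].
pose J u := \int[lam u]_x compl_fun Phi (h x).
(* [1 + `|J u - 1|] is a continuous majorant of [max 1 (J u)], exact at [u0]. *)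
pose b u := 1 + `|J u - 1|.
have b1 u : 1 <= b u by rewrite lerDl.
have Jb u : J u <= b u by have := ler_norm (J u - 1); rewrite /b; lra.
have bu0 : b u0 = 1 by rewrite /b /J Ja subrr normr0 addr0.
pose Q u := (\int[lam u]_x `|f x * h x|) / b u.
have QE : Q u0 = \int[lam u0]_x `|f x * h x| by rewrite /Q bu0 divr1.
have Q_le u : units u -> Q u <= fiber_norm u by move=> Uu; exact: (fiber_norm_ge Uu Ch (b1 u) (Jb u)).
have Ql := Q_le _ Uu0; have lP := fiber_norm_le Uu0 a0.
rewrite -QE -/(P a u0) in dual lP *; rewrite -/l in lP Ql.
have etaQ : eta * Q u0 <= e by rewrite (le_trans _ etal)// ler_pM2l.
(* Here [Q u0 <= l <= P a u0 <= (1 + eta) * Q u0] and [eta * Q u0 <= e], so both limits are within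
   [e] of [l]. *)
exists (P a), Q, (P a u0), (Q u0); split.
- exact: P_cvg.
- apply: cvgM.
    by apply: haar_Rintegral_cvg => //; apply: Cc_normM => //; case: Ch.
  apply: cvgV; first by rewrite bu0 oner_neq0.
  apply: cvgD; first exact: cvg_cst.
  apply: cvg_norm; apply: cvgB; last exact: cvg_cst.
  exact: haar_Rintegral_cvg.
- by move: dual; rewrite mulrDl mul1r; lra.
- by move: dual; rewrite mulrDl mul1r; lra.
- by rewrite near_withinE; apply: nearW => u Uu; rewrite Q_le//=; exact: fiber_norm_le.
Qed.

Lemma fiber_norm_eq0 u : units u -> (forall x, fiber u x -> f x = 0) ->
  fiber_norm u = 0.
Proof.
move=> Uu f0; rewrite /fiber_norm (_ : orlicz_norm _ _ _ _ = 0%E)//.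
apply/eqP; rewrite eq_le orlicz_norm_ge0// andbT.
apply: ge_ereal_sup => _ [k _ <-].
by rewrite integral0_eq// => x /f0 ->; rewrite mul0r normr0.
Qed.

Lemma fiber_norm_neq0 u : units u -> fiber_norm u != 0 ->
  exists2 x, fiber u x & f x != 0.
Proof.
move=> Uu; apply: contraPP => /forall2NP nf; apply/negP; rewrite negbK.
apply/eqP/fiber_norm_eq0 => // x ux.
by have [|/negP] := nf x => //; rewrite negbK => /eqP.
Qed.

Lemma fiber_norm_continuous : {within units, continuous fiber_norm}.
Proof.
apply/subspace_continuousP => u0 Uu0.
have [[x ux fx]|/forall2NP nf] := pselect (exists2 x, fiber u0 x & f x != 0).
  exact: fiber_norm_cvg ux fx.
apply: fiber_norm_cvg0 => // x ux.
by have [|/negP] := nf x => //; rewrite negbK => /eqP.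
Qed.

(** A nonzero norm at [u] forces [f x != 0] for some [x] over [u], so [u] lies in the image under
    [rng] of the support of [f], which is compact and hence closed. *)
Lemma fiber_norm_compact_support :
  compact (closure [set u | units u /\ fiber_norm u != 0]).
Proof.
pose K := rng @` closure [set x | f x != 0].
have cK : compact K.
  apply: continuous_compact; last by case: Cf.
  by apply: continuous_subspaceT; exact: rng_continuous.
apply: (subclosed_compact _ cK); first exact: closed_closure.
have /closure_id -> : closed K by exact: compact_closed.
apply: closureS => u [Uu /(fiber_norm_neq0 Uu)[x <- fx]].
by exists x => //; exact: subset_closure.
Qed.

End Norm.
End GroupoidOrlicz.

Unset Implicit Arguments.

Theorem theorem3p5 (R : realType) (T : ptopologicalType)
  (G2 : set (T * T)) (mul : T -> T -> T) (inv : T -> T)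
  (lam : T -> {measure set (borel T) -> \bar R})
  (Phi : R -> R) (f : T -> R) :
  @second_countable T -> locally_compact [set: T] -> hausdorff_space T ->
  top_groupoid G2 mul inv -> haar_system G2 mul inv lam ->
  N_function Phi -> Delta2 T Phi -> Cc f ->
  let g := fun u : T =>
    fine (orlicz_norm (compl_fun Phi) (lam u) (fiber mul inv u) f) in
  {within units mul inv, continuous g} /\
  compact (closure [set u | units mul inv u /\ g u != 0]).
Proof.
move=> _ _ hT topG haarG PhiN _ Cf g; split.
- exact: (fiber_norm_continuous hT topG haarG PhiN Cf).
- exact: (fiber_norm_compact_support hT topG PhiN Cf).
Qed.
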